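(* Let $n$ and $k$ be integers with $n \ge 2k+1 \ge 5$. Then the complement $\overline{K}(n,k)$ of the Kneser graph $K(n,k)$ satisfies Hadwiger's conjecture, that is, $$h(\overline{K}(n,k)) \ge \chi(\overline{K}(n,k)).$$
   Context: For integers $n \ge 2k+1$, the Kneser graph $K(n,k)$ has as vertices the $k$-subsets of $[n]=\{1,\dots,n\}$, two vertices being adjacent if and only if the corresponding $k$-subsets are disjoint; $\overline{K}(n,k)$ denotes its complement (two $k$-subsets are adjacent iff they intersect). For a graph $G$, $h(G)$ (the Hadwiger number) is the maximum integer $t$ such that $G$ contains the complete graph $K_t$ as a minor, and $\chi(G)$ is the chromatic number. Hadwiger's conjecture asserts $h(G)\ge\chi(G)$ for every graph $G$. *)

(* Defs.v *)
From mathcomp Require Import all_boot.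

Set Implicit Arguments.
Unset Strict Implicit.
Unset Printing Implicit Defensive.

Record sgraph := SGraph {
  vertex :> finType;
  adj : rel vertex;
  adj_sym : symmetric adj;
  adj_irrefl : irreflexive adj
}.

Section Complement.
Variable G : sgraph.

Definition compl_adj : rel G := fun x y => (x != y) && ~~ adj x y.

Lemma compl_adj_sym : symmetric compl_adj.
Proof. by move=> x y; rewrite /compl_adj eq_sym adj_sym. Qed.

Lemma compl_adj_irrefl : irreflexive compl_adj.
Proof. by move=> x; rewrite /compl_adj eqxx. Qed.

Definition compl_graph := SGraph compl_adj_sym compl_adj_irrefl.

End Complement.

Section Complete.
Variable t : nat.

Definition complete_adj : rel 'I_t := fun i j => i != j.

Lemma complete_adj_sym : symmetric complete_adj.
Proof. by move=> i j; rewrite /complete_adj eq_sym. Qed.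

Lemma complete_adj_irrefl : irreflexive complete_adj.
Proof. by move=> i; rewrite /complete_adj eqxx. Qed.

Definition complete_graph := SGraph complete_adj_sym complete_adj_irrefl.

End Complete.

Section Kneser.
Variables n k : nat.

Definition ksubset := {A : {set 'I_n} | #|A| == k}.

(* The conjunct [A != B] only matters for k = 0, where the empty set would be
   adjacent to itself. *)
Definition kneser_adj : rel ksubset :=
  fun A B => (A != B) && [disjoint val A & val B].

Lemma kneser_adj_sym : symmetric kneser_adj.
Proof. by move=> A B; rewrite /kneser_adj eq_sym disjoint_sym. Qed.

Lemma kneser_adj_irrefl : irreflexive kneser_adj.
Proof. by move=> A; rewrite /kneser_adj eqxx. Qed.

Definition kneser := SGraph kneser_adj_sym kneser_adj_irrefl.

Lemma compl_kneserE (A B : ksubset) :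
  @adj (compl_graph kneser) A B = (A != B) && (val A :&: val B != set0).
Proof.
by rewrite /= /compl_adj /= /kneser_adj setI_eq0; case: (A != B).
Qed.

End Kneser.

Section Chromatic.
Variable G : sgraph.

Definition proper_coloring (c : nat) (f : {ffun G -> 'I_c}) : bool :=
  [forall x : G, forall y : G, adj x y ==> (f x != f y)].

Definition colorable (c : nat) : bool :=
  [exists f : {ffun G -> 'I_c}, proper_coloring f].

Lemma ex_colorable : exists c, colorable c.
Proof.
exists #|G|; apply/existsP; exists [ffun x => enum_rank x].
apply/forallP=> x; apply/forallP=> y; apply/implyP=> xy.
rewrite !ffunE (inj_eq enum_rank_inj).
by apply: contraTneq xy => ->; rewrite adj_irrefl.
Qed.

Definition chromatic_number : nat := ex_minn ex_colorable.

End Chromatic.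

Section Minor.
Variables H G : sgraph.

Definition connected_in (S : {set G}) : bool :=
  [forall x in S, forall y in S,
     connect [rel u v : G | [&& u \in S, v \in S & adj u v]] x y].

(* A model of H in G: the branch sets [phi i] are contracted to the vertices
   of H; vertices outside them, and superfluous edges, are deleted. *)
Definition minor_model (phi : {ffun H -> {set G}}) : bool :=
  [&& [forall i : H, (phi i != set0) && connected_in (phi i)],
      [forall i : H, forall j : H, (i != j) ==> [disjoint phi i & phi j]]
    & [forall i : H, forall j : H, adj i j ==>
         [exists x in phi i, exists y in phi j, adj x y]]].

Definition minor : bool := [exists phi : {ffun H -> {set G}}, minor_model phi].

Lemma minor_card : minor -> #|H| <= #|G|.
Proof.
case/existsP=> phi /and3P[/forallP ne /forallP dis _].
have rep i : {x : G | x \in phi i}.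
  by apply/sigW/set0Pn; case/andP: (ne i).
apply: (@leq_card _ _ (fun i => sval (rep i))) => i j eq_ij.
apply/eqP/negP=> /negP ij.
have /forallP/(_ j)/implyP/(_ ij) := dis i.
by rewrite disjoint_subset => /subsetP/(_ _ (svalP (rep i)));
  rewrite eq_ij inE (svalP (rep j)).
Qed.

End Minor.

Section Hadwiger.
Variable G : sgraph.

Lemma ex_complete_minor : exists t, minor (complete_graph t) G.
Proof.
exists 0; apply/existsP; exists [ffun=> set0].
by apply/and3P; split; apply/forallP=> -[].
Qed.

Lemma complete_minor_bound t : minor (complete_graph t) G -> t <= #|G|.
Proof. by move/minor_card; rewrite card_ord. Qed.

Definition hadwiger_number : nat :=
  ex_maxn ex_complete_minor complete_minor_bound.

End Hadwiger.

(* Main.v *)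
From Stdlib Require Import ZArith.
Require Import Defs.
From mathcomp Require Import all_boot.
From mathcomp Require Import zify.

Set Implicit Arguments.
Unset Strict Implicit.
Unset Printing Implicit Defensive.

(** Let [n = q * k + r] with [r < k]. By Baranyai's theorem the [k]-subsets of an
    [n]-set split into classes of [q] pairwise disjoint sets, so the chromatic
    number is at most [C(n, k) / q] rounded up. Baranyai's theorem is proved by
    adding the points one at a time: the block of each class that receives the
    new point is found by Hall's theorem.

    For the Hadwiger number, take as singleton branch sets the [k]-sets through a
    point [o1]; these number [C(n-1, k-1)], which is enough when [r = 0]. Further
    branch sets are rows of sets [o2 |: T], with the [T] of a row pairwise
    disjoint and avoiding [o1] and [o2], and rows of sets [o3 |: T], with the [T]
    avoiding [o2] as well. Baranyai's theorem provides many such rows. A row is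
    connected through [o2] or [o3], and it is adjacent to all other branch sets
    as soon as it covers at least [n - k + 1] points. When it falls short by one
    or two points, Hall's theorem supplies extra [k]-sets that avoid [o1], [o2]
    and [o3] and meet the part of the ground set missed by the row. *)

(** * Hall's theorem *)

Section Hall.
Variables I T : finType.
Implicit Types (N : I -> {set T}) (J K : {set I}).

Definition hall_condition N :=
  [forall J : {set I}, #|J| <= #|\bigcup_(i in J) N i|].

Definition hall_remove N i x : I -> {set T} :=
  fun j => if j == i then N j :\ x else N j.

(* A violator of Hall's condition for [hall_remove N i x], without [i]. *)
Lemma hall_removeN N i x : hall_condition N ->
  ~~ hall_condition (hall_remove N i x) ->
  exists2 J : {set I}, i \notin J &
    #|(\bigcup_(j in J) N j) :|: (N i :\ x)| <= #|J|.
Proof.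
move=> /forallP hN /forallPn[J]; rewrite -ltnNge => ltJ.
have rmE K : i \notin K ->
    \bigcup_(j in K) hall_remove N i x j = \bigcup_(j in K) N j.
  move=> iK; apply: eq_bigr => j jK; rewrite /hall_remove.
  by case: eqP jK iK => [-> ->|].
have iJ : i \in J.
  by apply: contraTT ltJ => iJ; rewrite rmE // -leqNgt.
exists (J :\ i); first by rewrite !inE eqxx.
move: ltJ; rewrite (bigD1 i) //= {1}/hall_remove eqxx (cardsD1 i J) iJ.
rewrite add1n ltnS setUC.
rewrite (eq_bigl [in J :\ i]); last by move=> j; rewrite !inE andbC.
by rewrite rmE // !inE eqxx.
Qed.

(** Induction on the total size of the sets [N i]. If some [N i] contains [x != y], deleting one of
    the two preserves Hall's condition: otherwise the two violators contradict it by
    submodularity. *)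
Lemma hall N : hall_condition N ->
  exists2 f : I -> T, injective f & forall i, f i \in N i.
Proof.
have [m le_m] := ubnP (\sum_i #|N i|); elim: m N le_m => // m IHm N le_m hN.
have /forallP hNJ := hN.
have [/forallP small|/forallPn[i]] := boolP [forall i, #|N i| <= 1].
  have N1 i : exists x, N i == [set x].
    have /cards1P[x ->] : #|N i| == 1; last by exists x.
    by rewrite eqn_leq small /=; have := hNJ [set i]; rewrite cards1 big_set1.
  pose f i := xchoose (N1 i); have fE i : N i = [set f i].
    by apply/eqP; apply: (xchooseP (N1 i)).
  exists f => [i j fij|i]; last by rewrite fE set11.
  apply/eqP; have := hNJ [set i; j]; rewrite cards2.
  case: eqP => // /eqP ij; rewrite big_setU1 ?inE //= big_set1 !fE fij setUid.
  by rewrite cards1.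
rewrite -ltnNge => /card_gt1P[x [y [xN yN xy]]].
have IH z : z \in N i -> hall_condition (hall_remove N i z) ->
    exists2 f : I -> T, injective f & forall i, f i \in N i.
  move=> zN hz; have [|f finj fN] := IHm (hall_remove N i z) _ hz.
    rewrite ltnS in le_m; apply: leq_trans le_m; rewrite (bigD1 i) //= [ltnRHS](bigD1 i) //=.
    rewrite {1}/hall_remove eqxx (cardsD1 z (N i)) zN -addSn leq_add2l.
    by apply: leq_sum => j /negPf ji; rewrite /hall_remove ji.
  exists f => // j; have := fN j; rewrite /hall_remove.
  by case: ifP => // _; rewrite inE => /andP[].
have [/IH|/(hall_removeN hN)[J iJ leJ]] :=
  boolP (hall_condition (hall_remove N i x)); first exact.
have [/IH|/(hall_removeN hN)[K iK leK]] :=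
  boolP (hall_condition (hall_remove N i y)); first exact.
(* As [x != y], the union of the sets bounded in [leJ] and [leK] contains all neighbours of
   [i |: (J :|: K)], and their intersection contains those of [J :&: K]. *)
exfalso; move: (leq_add leJ leK); rewrite -cardsUI -[_ + #|K|]cardsUI leqNgt.
case/negP; apply: leq_ltn_trans (_ : _ <= #|i |: (J :|: K)|.-1 + #|J :&: K|) _.
  by rewrite cardsU1 inE negb_or iJ iK.
have := hNJ (i |: (J :|: K)); have := hNJ (J :&: K).
rewrite cardsU1 inE negb_or iJ iK /= add1n.
move=> leI leU; rewrite -addSn; apply: leq_add.
  apply: leq_trans leU _; apply/subset_leq_card/bigcupsP => j.
  rewrite !inE => /or3P[/eqP->|jJ|jK]; apply/subsetP=> z zN; rewrite !inE.
  - by rewrite zN !andbT; case: (eqVneq z x) => [->|]; rewrite ?xy !orbT.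
  - by have -> : z \in \bigcup_(j in J) N j by apply/bigcupP; exists j.
  - have -> : z \in \bigcup_(j in K) N j by apply/bigcupP; exists j.
    by rewrite !orbT.
apply: leq_trans leI _; apply/subset_leq_card/bigcupsP => j.
rewrite inE => /andP[jJ jK]; apply/subsetP=> z zN; rewrite !inE.
have -> : z \in \bigcup_(j in J) N j by apply/bigcupP; exists j.
by have -> : z \in \bigcup_(j in K) N j by apply/bigcupP; exists j.
Qed.

End Hall.

(* Hall's condition for the bipartite graph joining [i] to [c y] copies of [y]
   whenever [0 < w i y] follows by double counting the weight. *)
Lemma weighted_hall (I Y : finType) (w : I -> Y -> nat) (D : nat)
    (c : Y -> nat) :
  0 < D -> (forall i, \sum_y w i y = D) ->
  (forall y, \sum_i w i y = D * c y) ->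
  exists2 f : I -> Y, forall i, 0 < w i (f i) &
    forall y, #|[set i | f i == y]| = c y.
Proof.
move=> D0 rowD colD.
pose N i := [set s : {y : Y & 'I_(c y)} | 0 < w i (tag s)].
have cardN (P : pred Y) : #|[set s : {y : Y & 'I_(c y)} | P (tag s)]| =
    \sum_(y | P y) c y.
  rewrite -sum1_card (eq_bigl (fun s : {y : Y & 'I_(c y)} => P (tag s)));
    last by move=> s; rewrite inE.
  transitivity (\sum_(y | P y) \sum_(j < c y) 1); last first.
    by apply: eq_bigr => y _; rewrite sum1_card card_ord.
  by rewrite sig_big_dep /=; apply: eq_bigl => s; rewrite andbT.
have hN : hall_condition N.
  apply/forallP=> J; pose P y := [exists i in J, 0 < w i y].
  have -> : \bigcup_(i in J) N i =
      [set s : {y : Y & 'I_(c y)} | P (tag s)].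
    apply/setP=> s; rewrite inE; apply/bigcupP/exists_inP.
      by case=> i iJ; rewrite inE; exists i.
    by case=> i iJ wi; exists i; rewrite ?inE.
  rewrite cardN -(leq_pmul2l D0) big_distrr /=.
  rewrite -(eq_bigr _ (fun y _ => colD y)).
  rewrite mulnC -sum_nat_const -(eq_bigr _ (fun i _ => rowD i)) exchange_big /=.
  rewrite [leqLHS](bigID P) /= [X in _ + X]big1 ?addn0.
    apply: leq_sum => y _; rewrite [leqRHS](bigID (mem J)) /= leq_addr //.
  move=> y /exists_inPn Py; apply: big1 => i iJ; apply/eqP.
  by rewrite -leqn0 leqNgt; apply: Py.
have [g ginj gN] := hall hN; pose f i := tag (g i).
exists f => [i|]; first by have := gN i; rewrite inE.
(* Injectivity of [g] gives one inequality; both sides sum to [#|I|] over [y], so none is strict. *)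
have le_c y : #|[set i | f i == y]| <= c y.
  rewrite -[leqRHS](big_pred1_eq addn) -cardN -(card_imset _ ginj).
  by apply/subset_leq_card/subsetP => _ /imsetP[i + ->]; rewrite !inE.
have eq_sum : \sum_y #|[set i | f i == y]| = \sum_y c y.
  have -> : \sum_y #|[set i | f i == y]| = #|I|.
    rewrite -sum1_card (partition_big f predT) //=; apply: eq_bigr => y _.
    by rewrite -sum1_card; apply: eq_bigl => i; rewrite inE.
  apply/eqP; rewrite -(eqn_pmul2l D0) big_distrr /=.
  rewrite -(eq_bigr _ (fun y _ => colD y)) exchange_big /=.
  by rewrite (eq_bigr _ (fun i _ => rowD i)) sum_nat_const mulnC.
move=> y; apply/eqP; rewrite eqn_leq le_c /= leqNgt; apply/negP=> lt_y.
have := eq_sum; rewrite (bigD1 y) //= [RHS](bigD1 y) //=.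
have : \sum_(z | z != y) #|[set i | f i == z]| <= \sum_(z | z != y) c z.
  exact: leq_sum.
lia.
Qed.

(** * Baranyai's theorem and the chromatic number *)

Section Baranyai.
Variables (T B I : finType) (G : {set T}) (row : B -> I) (k : nat).

(* The traces [c b] on [A] of the blocks of an eventual solution: the last two
   clauses say that a row still has room for the points its blocks miss, and
   that [S] is the trace of as many blocks as there are [k]-sets meeting [A]
   exactly in [S]. *)
Definition partial_solution (A : {set T}) (c : B -> {set T}) :=
  [/\ forall b, c b \subset A /\ #|c b| <= k,
      forall b b', b != b' -> row b = row b' -> [disjoint c b & c b'],
      forall i, \sum_(b | row b == i) (k - #|c b|) <= #|G :\: A|
    & forall S : {set T}, S \subset A -> #|S| <= k ->
        #|[set b | c b == S]| = 'C(#|G :\: A|, k - #|S|)].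

Lemma sum_option (F : option {set T} -> nat) :
  \sum_y F y = F None + \sum_S F (Some S).
Proof.
rewrite (bigD1 None) //=; congr (_ + _).
rewrite (reindex_omap (@Some _) id) //=; last by case.
by apply: eq_bigl => S; rewrite eqxx.
Qed.

(** [w i (Some U)] is the room left in the blocks of row [i] with trace [U]; [None] takes up the
    slack of the row. By [weighted_hall] each row picks a trace or [None], each trace as often as it
    must receive [x], and one block with the picked trace gets [x]. *)
Lemma partial_solution_step A c x :
  partial_solution A c -> x \in G :\: A ->
  exists c', partial_solution (x |: A) c'.
Proof.
case=> sub dis cap cnt xGA.
have xA : x \notin A by move: xGA; rewrite inE => /andP[].
have xc b : x \notin c b by apply: contra xA; apply/subsetP; case: (sub b).
pose M := #|G :\: (x |: A)|.
have cardGA : #|G :\: A| = M.+1.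
  by rewrite (cardsD1 x) xGA /M setDDl setUC.
pose rem i := \sum_(b | row b == i) (k - #|c b|).
pose w (i : I) (y : option {set T}) : nat := if y is Some U then
  \sum_(b | (row b == i) && (c b == U)) (k - #|c b|) else M.+1 - rem i.
pose cS (S : {set T}) :=
  if (S \subset A) && (#|S| < k) then 'C(M, (k - #|S|).-1) else 0.
pose cy (y : option {set T}) :=
  if y is Some U then cS U else #|I| - \sum_S cS S.
have remE i : \sum_S w i (Some S) = rem i.
  by rewrite /rem (partition_big c predT).
have rem_le i : rem i <= M.+1 by rewrite -cardGA cap.
have roww i : \sum_y w i y = M.+1 by rewrite sum_option remE subnK.
have colS S : \sum_i w i (Some S) = M.+1 * cS S.
  transitivity (\sum_(b | c b == S) (k - #|S|)).
    rewrite [RHS](partition_big row predT) //=; apply: eq_bigr => i _.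
    by apply: eq_big => [b|b /andP[_ /eqP->]] //; rewrite andbC.
  rewrite sum_nat_cond_const /cS; case: (ltngtP #|S| k) => [ltk|gtk|->].
  - case: ifP => [/andP[sSA _]|].
      rewrite cnt ?(ltnW ltk) // cardGA [LHS]mulnC.
      have -> : k - #|S| = (k - #|S|).-1.+1 by lia.
      by rewrite -mul_bin_diag.
    rewrite andbT => /negP sSA; rewrite muln0 (_ : [set b | _] = set0) ?cards0 //.
    apply/setP=> b; rewrite !inE; apply/negP=> /eqP bS.
    by apply: sSA; rewrite -bS; case: (sub b).
  - rewrite andbF muln0; have -> : k - #|S| = 0 by lia.
    by rewrite muln0.
  - by rewrite subnn andbF !muln0.
have coly y : \sum_i w i y = M.+1 * cy y.
  case: y => [S|]; first exact: colS.
  rewrite /= sumnB // sum_nat_const -(eq_bigr _ (fun i _ => remE i)).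
  rewrite exchange_big /= -/w.
  rewrite mulnBr big_distrr /= mulnC; congr (_ - _).
  by apply: eq_bigr => S _; rewrite -colS.
have [f w_f cf] := weighted_hall (ltn0Sn M) roww coly.
pose h i := if f i is Some U then
  [pick b | (row b == i) && (c b == U)] else None.
pose sel b := h (row b) == Some b.
have hS i b : h i = Some b -> row b = i /\ f i = Some (c b).
  rewrite /h; case: (f i) => // S; case: pickP => // b' /andP[/eqP rb /eqP cb].
  by case=> <-; rewrite rb cb.
have hN i : h i = None -> f i = None.
  rewrite /h; have := w_f i; case: (f i) => // S /=; rewrite lt0n sum_nat_eq0.
  case/forallPn=> b; rewrite negb_imply => /andP[bP _].
  by case: pickP => // /(_ b); rewrite bP.
have selk b : sel b -> #|c b| < k.
  move=> /eqP/hS[_ fb]; have := w_f (row b); rewrite fb /= lt0n sum_nat_eq0.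
  by case/forallPn=> b'; rewrite negb_imply => /andP[/andP[_ /eqP<-]]; rewrite subn_eq0 -ltnNge.
pose c' b := if sel b then x |: c b else c b.
have cardc' b : #|c' b| = sel b + #|c b|.
  by rewrite /c'; case: ifP => //; rewrite cardsU1 xc.
have card_sel S : #|[set b | (c b == S) && sel b]| = cS S.
  rewrite -[RHS]/(cy (Some S)) -cf -(card_in_imset (f := row)); last first.
    move=> b b'; rewrite !inE => /andP[_ /eqP hb] /andP[_ /eqP hb'] eqr.
    by move: hb; rewrite eqr hb' => -[].
  apply: eq_card => i; rewrite inE; apply/imsetP/eqP => [[b]|fi].
    by rewrite inE => /andP[/eqP<- /eqP/hS[_ fb]] ->.
  case hi: (h i) => [b|]; last by rewrite (hN _ hi) in fi.
  have [rb fb] := hS _ _ hi; exists b => //.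
  by rewrite inE /sel rb hi eqxx andbT; move: fb; rewrite fi => -[->].
exists c'; split.
- move=> b; split; last by rewrite cardc'; case: (boolP (sel b)) => [/selk|]//; case: (sub b).
  have [sb _] := sub b; rewrite /c'; case: ifP => _; first exact: setUS.
  exact: subset_trans sb (subsetUr _ _).
- move=> b b' bb' rbb'; have := dis _ _ bb' rbb'.
  rewrite -!setI_eq0 /c' => /eqP cc0.
  have nsel : ~~ (sel b && sel b').
    by apply: contra bb' => /andP[/eqP hb /eqP]; rewrite -rbb' hb => -[->].
  case: (sel b) (sel b') nsel => [] [] //= _; rewrite ?cc0 //.
    by rewrite setIUl cc0 setU0 setI_eq0 disjoints1 xc.
  by rewrite setIUr cc0 setU0 setIC setI_eq0 disjoints1 xc.
(* Receiving [x] lowers the room of a row by one; a row that picked [None] has positive slack and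
   fits already. *)
- move=> i; rewrite -ltnS; case hi: (h i) => [b|].
    have [rb fb] := hS _ _ hi; apply: leq_trans (rem_le i).
    have sb : sel b by rewrite /sel rb hi.
    rewrite /rem (bigD1 b) ?rb //= [ltnRHS](bigD1 b) ?rb //= -addSn leq_add //.
      by rewrite cardc' sb; have := selk _ sb; lia.
    by apply: leq_sum => b' _; rewrite cardc'; lia.
  have := w_f i; rewrite (hN _ hi) /= subn_gt0; apply: leq_ltn_trans.
  by apply: leq_sum => b' _; rewrite cardc'; lia.
(* Traces containing [x] come from selected blocks; for the others the selected blocks are
   subtracted, which is Pascal's rule. *)
move=> S sSA leS; rewrite -/M; have [xS|xS] := boolP (x \in S).
  have -> : [set b | c' b == S] = [set b | (c b == S :\ x) && sel b].
    apply/setP=> b; rewrite !inE /c'; case: ifP => sb.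
      rewrite andbT; apply/eqP/eqP => [<-|->]; last exact: setD1K.
      by rewrite setU1K.
    by rewrite andbF; apply: contraNF (xc b) => /eqP->.
  rewrite card_sel /cS.
  have := cardsD1 x S; rewrite xS => cardS.
  have -> : S :\ x \subset A by rewrite subDset.
  by case: ifP => [_|]; [congr 'C(_, _)|]; lia.
have sSA' : S \subset A.
  apply/subsetP=> z zS; have := subsetP sSA _ zS; rewrite !inE.
  by case: eqP zS xS => // -> ->.
have -> : [set b | c' b == S] = [set b | c b == S] :\: [set b | (c b == S) && sel b].
  apply/setP=> b; rewrite !inE /c'; case: ifP => sb; rewrite ?andbT ?andbF //=.
  by rewrite andNb; apply: contraNF xS => /eqP<-; rewrite setU11.
rewrite cardsD (setIidPr _); last by apply/subsetP=> b; rewrite !inE => /andP[].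
rewrite cnt // cardGA card_sel /cS sSA' /=.
case: ltnP => kS; last first.
  have -> : k - #|S| = 0 by lia.
  by rewrite !bin0.
have -> : k - #|S| = (k - #|S|).-1.+1 by lia.
by rewrite /= binS addnK.
Qed.

(** Points of [G] are added to initially empty blocks. Once [A = G], no room is left, so every block
    has [k] points, and the count ['C(0, 0) = 1] makes the blocks distinct. *)
Lemma baranyai :
  #|B| = 'C(#|G|, k) -> (forall i, #|[set b | row b == i]| * k <= #|G|) ->
  exists c : B -> {set T},
    [/\ injective c, forall b, c b \subset G /\ #|c b| = k
      & forall b b', b != b' -> row b = row b' -> [disjoint c b & c b']].
Proof.
move=> cardB cardrow.
have stepA m : m <= #|G| ->
    exists2 A : {set T}, A \subset G /\ #|A| = m & exists c, partial_solution A c.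
  elim: m => [_|m IHm ltm].
    exists set0; first by rewrite sub0set cards0.
    exists (fun=> set0); split => [b|b b' _ _|i|S].
    - by rewrite sub0set cards0.
    - by rewrite -setI_eq0 setI0.
    - rewrite setD0; apply: leq_trans (cardrow i); rewrite cards0 subn0.
      by rewrite sum_nat_const cardsE.
    rewrite subset0 => /eqP-> _; rewrite setD0 cards0 subn0 -cardB.
    by apply: eq_card => b; rewrite !inE eqxx.
  have [A [sAG cA] [c solc]] := IHm (ltnW ltm).
  have [x xGA] : exists x, x \in G :\: A.
    by apply/set0Pn; rewrite -card_gt0 cardsD (setIidPr sAG) cA subn_gt0.
  have [c' solc'] := partial_solution_step solc xGA.
  move: xGA; rewrite inE => /andP[xA xG]; exists (x |: A); last by exists c'.
  by rewrite subUset sub1set xG sAG cardsU1 xA cA.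
have [A [sAG cA] [c [sub dis cap cnt]]] := stepA _ (leqnn _).
have AG : A = G by apply/eqP; rewrite eqEcard sAG cA /=.
rewrite {A sAG cA}AG setDv cards0 in sub cap cnt.
have cardc b : #|c b| = k.
  have := cap (row b); rewrite leqn0 sum_nat_eq0 => /forallP/(_ b).
  by rewrite eqxx /= subn_eq0; have [_] := sub b; lia.
exists c; split=> // [b b' cbb'|b]; last by split=> //; case: (sub b).
have [sb kb] := sub b; have /eqP/cards1P[z zP] : #|[set d | c d == c b]| = 1.
  by rewrite cnt // cardc subnn.
have : b \in [set d | c d == c b] by rewrite inE.
have : b' \in [set d | c d == c b] by rewrite inE cbb'.
by rewrite zP !inE => /eqP-> /eqP->.
Qed.

End Baranyai.

Lemma baranyai_div (T : finType) (G : {set T}) (k s : nat) :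
  0 < s -> s * k <= #|G| ->
  exists c : 'I_('C(#|G|, k)) -> {set T},
    [/\ injective c, forall b, c b \subset G /\ #|c b| = k
      & forall b b' : 'I_('C(#|G|, k)),
          b != b' -> b %/ s = b' %/ s -> [disjoint c b & c b']].
Proof.
move=> s0 skG; set C := 'C(_, _).
pose row (b : 'I_C) : 'I_C := Ordinal (leq_ltn_trans (leq_div b s) (ltn_ord b)).
have [|i|c [cinj csub cdis]] := @baranyai _ _ _ G row k.
- by rewrite card_ord.
- apply: leq_trans skG; rewrite leq_mul2r; apply/orP; right.
  pose r (b : 'I_C) : 'I_s := Ordinal (ltn_pmod b s0).
  rewrite -[s in _ <= s]card_ord -(card_in_imset (f := r)) ?max_card //.
  move=> b b'; rewrite !inE => /eqP <- /eqP[eqd] [eqm].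
  by apply: val_inj; rewrite /= (divn_eq b s) eqm -eqd -divn_eq.
exists c; split=> // b b' bb' eqd; apply: cdis => //.
exact: val_inj.
Qed.

Lemma card_ksubset n k : #|{: ksubset n k}| = 'C(n, k).
Proof.
rewrite card_sig -[n in RHS]card_ord -card_draws.
by apply: eq_card => A; rewrite !inE.
Qed.

(** The colour of a [k]-set is the index of its Baranyai row: distinct sets of a row are disjoint,
    hence not adjacent in the complement. *)
Lemma chromatic_number_le (n k q t : nat) :
  0 < q -> q * k <= n -> 'C(n, k) <= q * t ->
  chromatic_number (compl_graph (kneser n k)) <= t.
Proof.
move=> q0 qkn leC; rewrite /chromatic_number; case: ex_minnP => m _; apply.
have [|c [cinj csub cdis]] := @baranyai_div _ [set: 'I_n] k q q0.
  by rewrite cardsT card_ord.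
have ck b : #|c b| == k by apply/eqP; case: (csub b).
pose v b : ksubset n k := exist _ (c b) (ck b).
have vinj : injective v by move=> b b' /(congr1 val)/cinj.
have [g vK gK] : bijective v.
  by apply: inj_card_bij => //; rewrite card_ksubset card_ord cardsT card_ord.
have gt A : g A %/ q < t.
  rewrite ltn_divLR // mulnC; apply: leq_trans leC; apply: leq_trans (ltn_ord _) _.
  by rewrite cardsT card_ord.
apply/existsP; exists [ffun A => Ordinal (gt A)].
apply/forallP=> A1; apply/forallP=> A2; apply/implyP; rewrite !ffunE => /andP[A12].
apply: contra => /eqP[eqd]; rewrite /= /kneser_adj A12 /=.
rewrite -(gK A1) -(gK A2); apply: cdis => //.
by rewrite (can_eq gK).
Qed.

Lemma hadwiger_number_ge (G : sgraph) (J : finType) (phi : J -> {set G}) :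
  (forall i, phi i != set0) -> (forall i, connected_in (phi i)) ->
  (forall i j, i != j -> [disjoint phi i & phi j]) ->
  (forall i j, i != j -> exists x y, [/\ x \in phi i, y \in phi j & adj x y]) ->
  #|J| <= hadwiger_number G.
Proof.
move=> ne con dis tch; rewrite /hadwiger_number; case: ex_maxnP => m _; apply.
apply/existsP; exists [ffun i : 'I_#|J| => phi (enum_val i)].
apply/and3P; split; apply/forallP=> i; rewrite ?ffunE ?ne ?con //;
  apply/forallP=> j; apply/implyP; rewrite !ffunE => ij;
  have neq : enum_val i != enum_val j by rewrite (inj_eq enum_val_inj).
  exact: dis.
have [x [y [xi yj xy]]] := tch _ _ neq.
by apply/exists_inP; exists x => //; apply/exists_inP; exists y.
Qed.

Lemma card_draws_meet (T : finType) (Y D : {set T}) k : D \subset Y ->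
  #|[set A : {set T} | (A \subset Y) && (#|A| == k) & A :&: D != set0]| =
    'C(#|Y|, k) - 'C(#|Y| - #|D|, k).
Proof.
move=> DY; rewrite -{2}(setIidPr DY) -cardsD -!cards_draws.
rewrite -(cardsID [set A : {set T} | A :&: D == set0] 
  [set A : {set T} | A \subset Y & #|A| == k]).
rewrite [X in _ = X + _ - _](_ : _ = #|[set A : {set T} | A \subset Y :\: D & #|A| == k]|).
  rewrite addKn; apply: eq_card => A; rewrite !inE.
  by case: (A \subset Y) (#|A| == k) (A :&: D == set0) => [] [] [].
apply: eq_card => A; rewrite !inE subsetD -setI_eq0.
by case: (A \subset Y) (#|A| == k) (A :&: D == set0) => [] [] [].
Qed.

Lemma ex_blocks (T : finType) (M : {set T}) d c : d * c <= #|M| ->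
  exists D : 'I_d -> {set T},
    [/\ forall j, D j \subset M, forall j, c <= #|D j|
      & forall j j', j != j' -> [disjoint D j & D j']].
Proof.
(* For [0 < c] the pieces are runs of length [c] in the enumeration of [M]. *)
move=> dcM; exists (fun j : 'I_d => [set x in M | index x (enum M) %/ c == j]); split.
- by move=> j; apply/subsetP=> x; rewrite inE => /andP[].
- move=> j; case: c dcM => // c dcM.
  have lt_size (i : 'I_c.+1) : j * c.+1 + i < size (enum M).
    rewrite -cardE; apply: leq_trans dcM; have := ltn_ord j; have := ltn_ord i.
    by move: (nat_of_ord i) (nat_of_ord j) => a b; nia.
  have x0 : T by have := lt_size ord0; case: (enum M) => // x.
  pose g (i : 'I_c.+1) := nth x0 (enum M) (j * c.+1 + i).
  have ginj : injective g.
    move=> i i' /eqP; rewrite nth_uniq ?enum_uniq // eqn_add2l => /eqP.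
    exact: val_inj.
  rewrite -[leqLHS]card_ord -cardsT -(card_imset _ ginj).
  apply/subset_leq_card/subsetP=> _ /imsetP[i _ ->].
  rewrite inE -mem_enum mem_nth // index_uniq ?enum_uniq //.
  by rewrite divnMDl // divn_small ?ltn_ord // addn0 eqxx.
move=> j j' jj'; rewrite -setI_eq0; apply/eqP/setP=> x; rewrite !inE.
apply/negP=> /andP[/andP[_ /eqP jE] /andP[_ /eqP j'E]].
by move: jj'; rewrite -val_eqE /= -jE -j'E eqxx.
Qed.

(** * Minors made of a star and of rows *)

Lemma card_star n k (o : 'I_n) : 0 < k ->
  #|{: {v : ksubset n k | o \in val v}}| = 'C(n.-1, k.-1).
Proof.
move=> k0; have n0 : 0 < n by apply: leq_ltn_trans (ltn_ord o).
rewrite card_sig.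
transitivity #|[set A : {set 'I_n} |
    (A \subset [set: 'I_n]) && (#|A| == k) & A :&: [set o] != set0]|.
  rewrite -(card_image val_inj); apply: eq_card => A; rewrite !inE subsetT /=.
  rewrite setI_eq0 disjoint_sym disjoints1 negbK.
  apply/imageP/andP => [[v ov ->]|[kA oA]]; first by split=> //; apply: valP v.
  by exists (exist _ A kA).
rewrite card_draws_meet ?subsetT // cards1 cardsT card_ord subn1.
by case: n k n0 k0 {o} => [|n] [|k] //= _ _; rewrite binS addKn.
Qed.

Lemma cardsI_gt0 (T : finType) (X A B : {set T}) :
  A \subset X -> B \subset X -> #|X| < #|A| + #|B| -> A :&: B != set0.
Proof.
move=> AX BX ltX; rewrite -card_gt0; have := cardsUI A B.
have : #|A :|: B| <= #|X| by rewrite subset_leq_card // subUset AX.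
lia.
Qed.

(** Sets through [o] meet in [o]. The rest is pigeonhole on the [n - 1] other points: a cover has at
    least [n - k + 1] of them, enough to meet the [k - 1] other points of a set through [o] and, as
    [2 * k <= n], every other cover. Members of [F i] are connected through sets containing
    [a i]. *)
Lemma hadwiger_star (n k : nat) (o : 'I_n) (J : finType)
    (F : J -> {set {set 'I_n}}) (a : J -> 'I_n) :
  0 < k -> 2 * k <= n ->
  (forall i A, A \in F i -> #|A| = k /\ o \notin A) ->
  (forall i, F i != set0) ->
  (forall i A, A \in F i ->
    exists2 B, B \in F i & a i \in B /\ A :&: B != set0) ->
  (forall i j, i != j -> [disjoint F i & F j]) ->
  (forall i, n < k + #|cover (F i)|) ->
  'C(n.-1, k.-1) + #|J| <= hadwiger_number (compl_graph (kneser n k)).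
Proof.
move=> k0 kn Fk Fne Fa Fdis Fcov.
rewrite -(card_star o k0) -card_sum.
set G := compl_graph _.
have adjE (u v : G) : adj u v = (u != v) && (val u :&: val v != set0).
  exact: compl_kneserE.
have vk (v : G) : #|val v| = k by apply/eqP; apply: (valP v).
pose St := {v : ksubset n k | o \in val v}.
pose V (s : St + J) : {set {set 'I_n}} :=
  match s with inl v => [set val (val v)] | inr i => F i end.
pose phi s : {set G} := [set v : ksubset n k | val v \in V s].
have vko (v : St) : #|val (val v) :\ o|.+1 = k.
  by rewrite -[RHS](vk (val v)) [in RHS](cardsD1 o) (valP v).
have Vk s A : A \in V s -> #|A| = k.
  by case: s => [v|i] /=; [rewrite inE => /eqP->; apply: vk|move=> /Fk[]].
have lift s A : A \in V s -> exists2 v : G, v \in phi s & val v = A.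
  move=> As; have kA : #|A| == k by apply/eqP/(Vk s).
  by exists (exist _ A kA : ksubset n k); rewrite ?inE.
have Vdis s s' : s != s' -> [disjoint V s & V s'].
  case: s s' => [v|i] [v'|i'] /= ss'.
  - rewrite disjoints1 inE; apply: contra ss' => /eqP/val_inj/val_inj->.
    by rewrite eqxx.
  - rewrite disjoints1; apply/negP=> /Fk[_ /negP]; apply; exact: (valP v).
  - rewrite disjoint_sym disjoints1; apply/negP=> /Fk[_ /negP]; apply.
    exact: (valP v').
  - by apply: Fdis; apply: contra ss' => /eqP->.
have coverX i : cover (F i) \subset ~: [set o].
  apply/bigcupsP=> A /Fk[_ oA]; apply/subsetP=> x xA.
  by rewrite !inE; apply: contraNneq oA => <-.
have cardX : #|~: [set o]| = n.-1 by rewrite cardsC1 card_ord.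
have tchF (X : {set 'I_n}) i : X \subset ~: [set o] ->
    n.-1 < #|X| + #|cover (F i)| -> exists2 A, A \in F i & X :&: A != set0.
  rewrite -cardX => oX ltX; have /set0Pn[x] := cardsI_gt0 oX (coverX i) ltX.
  rewrite inE => /andP[xX /bigcupP[A AF xA]]; exists A => //.
  by apply/set0Pn; exists x; rewrite inE xX.
have VM s s' : s != s' ->
    exists A B, [/\ A \in V s, B \in V s' & A :&: B != set0].
  have starF (v : St) i : exists2 A, A \in F i & val (val v) :&: A != set0.
    have [||A AF meet] := tchF (val (val v) :\ o) i.
    - by apply/subsetP=> x; rewrite !inE => /andP[].
    - have := Fcov i; have := vko v; move: #|_ :\ _| #|cover _| => p p'; lia.
    exists A => //; case/set0Pn: meet => x; rewrite !inE -andbA => /and3P[_ xv xA].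
    by apply/set0Pn; exists x; rewrite inE xv.
  case: s s' => [v|i] [v'|i'] /= ss'.
  - exists (val (val v)), (val (val v')); rewrite !inE !eqxx; split=> //.
    by apply/set0Pn; exists o; rewrite inE (valP v) (valP v').
  - have [A AF meet] := starF v i'.
    by exists (val (val v)), A; split=> //; rewrite inE.
  - have [A AF meet] := starF v' i.
    by exists A, (val (val v')); split=> //; rewrite ?inE // setIC.
  - have [|B BF] := tchF _ i' (coverX i).
      by have := Fcov i; have := Fcov i'; lia.
    case/set0Pn=> x; rewrite inE => /andP[/bigcupP[A AF xA] xB].
    by exists A, B; split=> //; apply/set0Pn; exists x; rewrite inE xA.
apply: (hadwiger_number_ge (phi := phi)) => [s|s|s s' ss'|s s' ss'].
- have [A As] : exists A, A \in V s.
    case: s => [v|i] /=; last by apply/set0Pn/Fne.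
    by exists (val (val v)); rewrite inE.
  by have [v vs _] := lift s A As; apply/set0Pn; exists v.
- pose r := [rel u v : G | [&& u \in phi s, v \in phi s & adj u v]].
  have conn1 u v : u \in phi s -> v \in phi s -> val u :&: val v != set0 ->
      connect r u v.
    move=> us vs uv; have [->|neq] := eqVneq u v; first exact: connect0.
    by apply: connect1; apply/and3P; split=> //; rewrite adjE neq.
  apply/forall_inP=> u us; apply/forall_inP=> v vs; rewrite -/r.
  case: s @r us vs conn1 => [w|i] r.
    rewrite !inE => /eqP uw /eqP vw _.
    by have -> : u = v by apply: val_inj; rewrite uw vw.
  move=> us vs conn1.
  have [|A AF [aA uA]] := Fa i (val u); first by move: us; rewrite inE.
  have [|B BF [aB vB]] := Fa i (val v); first by move: vs; rewrite inE.
  have [x xs xA] := lift (inr i) A AF; have [y ys yB] := lift (inr i) B BF.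
  apply: (@connect_trans _ _ x); first by apply: conn1; rewrite ?xA.
  apply: (@connect_trans _ _ y); last by apply: conn1; rewrite ?yB // setIC.
  by apply: conn1; rewrite // xA yB; apply/set0Pn; exists (a i); rewrite inE aA.
- rewrite -setI_eq0; apply/eqP/setP=> v; rewrite !inE.
  apply/negP=> /andP[vs vs']; have := Vdis _ _ ss'.
  by rewrite disjoint_subset => /subsetP/(_ _ vs); rewrite inE vs'.
have [A [B [As Bs' AB]]] := VM _ _ ss'.
have [u us uA] := lift _ _ As; have [v vs vB] := lift _ _ Bs'.
exists u, v; split=> //; rewrite adjE uA vB AB andbT.
apply/eqP=> uv; have := Vdis _ _ ss'; rewrite disjoint_subset => /subsetP/(_ _ As).
by rewrite inE -uA uv vB Bs'.
Qed.

(* Row [i] receives [d i] extra [k]-subsets of [Y], each of which meets its own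
   piece, of size at least [c], of the part of [Y] missed by the row. Hall's
   condition holds because each extra set has as many candidates as there are
   extra sets in total. *)
Lemma hadwiger_star_extend (n k : nat) (o : 'I_n) (J : finType)
    (F : J -> {set {set 'I_n}}) (a : J -> 'I_n) (Y : {set 'I_n})
    (d : J -> nat) (c : nat) :
  0 < k -> 2 * k <= n -> 0 < c -> o \notin Y -> (forall i, a i \notin Y) ->
  (forall i A, A \in F i -> [/\ #|A| = k, o \notin A & a i \in A]) ->
  (forall i, F i != set0) ->
  (forall i j, i != j -> [disjoint F i & F j]) ->
  (forall i, d i * c <= #|Y :\: cover (F i)|) ->
  (forall i, 0 < d i -> #|Y :\: cover (F i)| < k) ->
  (forall i, n < k + #|cover (F i)| + d i) ->
  \sum_i d i <= 'C(#|Y|, k) - 'C(#|Y| - c, k) ->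
  'C(n.-1, k.-1) + #|J| <= hadwiger_number (compl_graph (kneser n k)).
Proof.
move=> k0 kn c0 oY aY Fk Fne Fdis dM Mk Fcov sumd.
have [D DP] := fin_all_exists (fun i => ex_blocks (dM i)).
pose Q := {i : J & 'I_(d i)}.
pose N (q : Q) := [set A : {set 'I_n} |
  (A \subset Y) && (#|A| == k) & A :&: D (tag q) (tagged q) != set0].
have DY (q : Q) : D (tag q) (tagged q) \subset Y :\: cover (F (tag q)).
  by case: (DP (tag q)).
have cardQ : #|{: Q}| = \sum_i d i.
  by rewrite card_tagged sumnE big_map big_enum; apply: eq_bigr => i _; rewrite card_ord.
have cardN q : #|{: Q}| <= #|N q|.
  rewrite cardQ card_draws_meet ?(subset_trans (DY q)) ?subsetDl //.
  apply: leq_trans sumd _; apply/leq_sub2l/leq_bin2l/leq_sub2l.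
  by case: (DP (tag q)).
have [|e einj eN] := @hall _ _ N.
  apply/forallP=> K; have [->|/set0Pn[q qK]] := eqVneq K set0.
    by rewrite cards0.
  apply: leq_trans (max_card _) (leq_trans (cardN q) _).
  exact/subset_leq_card/bigcup_sup.
pose tg i (j : 'I_(d i)) : Q := Tagged (fun i => 'I_(d i)) j.
pose E i := [set e (tg i j) | j in 'I_(d i)].
have EY i A : A \in E i -> A \subset Y /\ #|A| = k.
  case/imsetP=> j _ ->; have := eN (tg i j).
  by rewrite inE => /andP[/andP[-> /eqP->]].
have FEdis i j : [disjoint F i & E j].
  rewrite -setI_eq0; apply/eqP/setP=> A; rewrite !inE; apply/negP=> /andP[].
  by move=> /Fk[_ _ aA] /EY[/subsetP/(_ _ aA) aiY _]; have := aY i; rewrite aiY.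
apply: (hadwiger_star (F := fun i => F i :|: E i) (a := a) (o := o)) => //.
- move=> i A; rewrite inE => /orP[/Fk[]//|/EY[AY kA]]; split=> //.
  by apply: contra oY; apply/subsetP.
- by move=> i; rewrite setU_eq0 negb_and Fne.
- move=> i A; rewrite inE => /orP[AF|AE].
    have [kA _ aA] := Fk _ _ AF; exists A; first by rewrite inE AF.
    by split=> //; rewrite setIid -card_gt0 kA.
  have [AY kA] := EY _ _ AE.
  have d0 : 0 < d i by case/imsetP: AE => j _ _; apply: leq_ltn_trans (ltn_ord j).
  (* The extra set has more points than the row misses in [Y], so it meets a set of the row, which
     contains [a i]. *)
  have : ~~ (A \subset Y :\: cover (F i)).
    by apply/negP=> /subset_leq_card; rewrite kA leqNgt Mk.
  case/subsetPn=> x xA; rewrite inE negb_and negbK (subsetP AY) // orbF.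
  case/bigcupP=> B BF xB; exists B; first by rewrite inE BF.
  split; first by case: (Fk _ _ BF).
  by apply/set0Pn; exists x; rewrite inE xA.
- move=> i j ij; rewrite -setI_eq0; apply/eqP/setP=> A; rewrite !inE.
  have nFE i' j' : ~ (A \in F i' /\ A \in E j').
    case=> AF AE; have := FEdis i' j'; rewrite disjoint_subset.
    by move=> /subsetP/(_ _ AF); rewrite inE AE.
  apply/negP=> /andP[/orP[AF|AE] /orP[AF'|AE']].
  - have := Fdis _ _ ij; rewrite disjoint_subset.
    by move=> /subsetP/(_ _ AF); rewrite inE AF'.
  - by apply: (nFE i j).
  - by apply: (nFE j i).
  case/imsetP: AE AE' => x _ -> /imsetP[y _ /einj/(congr1 tag)/eqP].
  by rewrite /= (negPf ij).
move=> i.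
(* Each extra set contributes a point of its own piece, so the cover gains [d i] points. *)
have [x xP] : exists x : 'I_(d i) -> 'I_n,
    forall j, x j \in e (tg i j) :&: D i j.
  apply: (fin_all_exists (P := fun j y => y \in e (tg i j) :&: D i j)) => j; apply/set0Pn.
  by have := eN (tg i j); rewrite inE => /andP[].
have [Dsub _ Ddis] := DP i.
have xinj : injective x.
  move=> j j' eqx; apply/eqP/negPn/negP=> /Ddis; rewrite disjoint_subset.
  have := xP j; rewrite inE => /andP[_ xD] /subsetP/(_ _ xD).
  by rewrite eqx inE; have := xP j'; rewrite inE => /andP[_ ->].
apply: leq_trans (Fcov i) _; rewrite -addnA leq_add2l.
have -> : d i = #|x @: setT| by rewrite card_imset // cardsT card_ord.
have cov0 : cover (F i) :&: x @: setT = set0.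
  apply/setP=> y; rewrite !inE; apply/negP=> /andP[yF /imsetP[j _ yx]].
  have := xP j; rewrite inE -yx => /andP[_ /(subsetP (Dsub j))].
  by rewrite inE yF.
rewrite -cardsUI cov0 cards0 addn0.
apply/subset_leq_card; rewrite subUset; apply/andP; split.
  apply/bigcupsP=> A AF; apply: (bigcup_sup A) => //.
  by rewrite inE AF.
apply/subsetP=> _ /imsetP[j _ ->]; apply/bigcupP; exists (e (tg i j)).
  by rewrite inE imset_f ?orbT.
by have := xP j; rewrite inE => /andP[].
Qed.

(** Row [i] consists of the [s] Baranyai blocks numbered from [i * s] on, with [z] added to each;
    the bound on [s * m] makes all [m] rows full. *)
Lemma leader_rows (T : finType) (G : {set T}) (z : T) k s m :
  z \notin G -> 0 < s -> 0 < k -> s * k <= #|G| -> s * m <= 'C(#|G|, k) ->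
  exists F : 'I_m -> {set {set T}},
    [/\ forall i A, A \in F i -> [/\ #|A| = k.+1, A \subset z |: G & z \in A],
        forall i, F i != set0, forall i j, i != j -> [disjoint F i & F j]
      & forall i, cover (F i) \subset z |: G /\ #|cover (F i)| = (s * k).+1].
Proof.
move=> zG s0 k0 skG smC; have [c [cinj csub cdis]] := baranyai_div s0 skG.
have ltb (i : 'I_m) (j : 'I_s) : i * s + j < 'C(#|G|, k).
  apply: leq_trans smC; have := ltn_ord i; have := ltn_ord j.
  by move: (nat_of_ord i) (nat_of_ord j) => x y; nia.
pose b i j := Ordinal (ltb i j).
have bs i j : b i j %/ s = i by rewrite /= divnMDl // divn_small ?addn0.
have binj i j j' : b i j = b i j' -> j = j'.
  by move=> [] /eqP; rewrite eqn_add2l => /eqP/val_inj.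
have zc x : z \notin c x by apply: contra zG; apply/subsetP; case: (csub x).
pose F i := [set z |: c (b i j) | j in 'I_s].
have Fb i j : z |: c (b i j) \in F i by apply: imset_f.
have coverE i : cover (F i) = z |: \bigcup_j c (b i j).
  apply/setP=> x; apply/bigcupP/setU1P => [[_ /imsetP[j _ ->]]|[->|/bigcupP[j _ xj]]].
  - by rewrite !inE => /orP[/eqP->|xj]; [left|right; apply/bigcupP; exists j].
  - by exists (z |: c (b i (Ordinal s0))); rewrite ?setU11 ?Fb.
  - by exists (z |: c (b i j)); rewrite ?Fb // inE xj orbT.
have subG i : \bigcup_j c (b i j) \subset G.
  by apply/bigcupsP=> j _; case: (csub (b i j)).
exists F; split.
- move=> i _ /imsetP[j _ ->]; have [cG ck] := csub (b i j).
  by rewrite cardsU1 zc ck setU11 setUS.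
- by move=> i; apply/set0Pn; exists (z |: c (b i (Ordinal s0))).
- move=> i i' ii'; rewrite -setI_eq0; apply/eqP/setP=> A; rewrite !inE.
  apply/negP=> /andP[/imsetP[j _ ->] /imsetP[j' _ eqc]].
  have /cinj/(congr1 (fun x : 'I_ _ => x %/ s)) : c (b i j) = c (b i' j').
    by rewrite -(setU1K (zc (b i j))) eqc setU1K.
  by rewrite !bs => /val_inj/eqP; rewrite (negPf ii').
move=> i; rewrite coverE setUS // cardsU1.
have -> : z \notin \bigcup_j c (b i j).
  by apply: contra zG; apply/subsetP.
rewrite add1n; split=> //; congr _.+1.
rewrite -sum1_card partition_disjoint_bigcup => [|j j' jj'].
  rewrite -[s in RHS]card_ord -sum_nat_const; apply: eq_bigr => j _.
  by rewrite sum1_card; case: (csub (b i j)).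
apply: cdis; last by rewrite !bs.
by apply: contra jj' => /eqP/binj->.
Qed.

(* [s2] and [s3] are the lengths, [m2] and [m3] the numbers of the rows through
   the second and third point; [d2], [d3] and [c] are as in
   [hadwiger_star_extend]. *)
Lemma hadwiger_leaders n k s2 m2 d2 s3 m3 d3 c :
  1 < k -> 2 * k < n -> 0 < c ->
  [/\ 0 < s2, s2 * k.-1 <= n - 2 & s2 * m2 <= 'C(n - 2, k.-1)] ->
  [/\ n <= k + s2 * k.-1 + d2, d2 <= 1 & d2 * c <= n - 3 - s2 * k.-1] ->
  (0 < m3 ->
    [/\ 0 < s3, s3 * k.-1 <= n - 3 & s3 * m3 <= 'C(n - 3, k.-1)] /\
    [/\ n <= k + s3 * k.-1 + d3, d3 <= 2 & d3 * c <= n - 3 - s3 * k.-1]) ->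
  d2 * m2 + d3 * m3 <= 'C(n - 3, k) - 'C(n - 3 - c, k) ->
  'C(n.-1, k.-1) + (m2 + m3) <= hadwiger_number (compl_graph (kneser n k)).
Proof.
move=> k1 kn c0 [s20 s2n s2m] [cov2 d21 d2c] H3 pool.
have n2 : 2 < n by lia.
pose o1 : 'I_n := Ordinal (ltn_trans (ltn_trans (ltnSn 0) (ltnSn 1)) n2).
pose o2 : 'I_n := Ordinal (ltn_trans (ltnSn 1) n2).
pose o3 : 'I_n := Ordinal n2.
(* Rows through [o2] may use [o3], but those through [o3] avoid [o2], so no set occurs in both
   kinds. Extra sets lie in [Y], so they occur in neither. *)
pose Y := ~: (o1 |: [set o2; o3]).
have Yn : #|Y| = n - 3 by rewrite cardsCs setCK card_ord cardsU1 cards2 !inE.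
pose G := o3 |: Y.
have Gn : #|G| = n - 2 by rewrite cardsU1 !inE Yn /=; lia.
have k10 : 0 < k.-1 by lia.
have o2G : o2 \notin G by rewrite !inE.
have o3Y : o3 \notin Y by rewrite !inE.
have [||F2 [F2k F2ne F2dis F2cov]] := @leader_rows _ G o2 k.-1 s2 m2 o2G s20 k10;
  rewrite ?Gn //.
have [F3 [F3k F3ne F3dis F3cov]] : exists F3 : 'I_m3 -> {set {set 'I_n}},
    [/\ forall i A, A \in F3 i -> [/\ #|A| = k.-1.+1, A \subset o3 |: Y & o3 \in A],
        forall i, F3 i != set0, forall i j, i != j -> [disjoint F3 i & F3 j]
      & forall i, cover (F3 i) \subset o3 |: Y /\ #|cover (F3 i)| = (s3 * k.-1).+1].
  case: (posnP m3) => [m30|/H3[[s30 s3n s3m] _]].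
    by exists (fun=> set0); split=> i; have := ltn_ord i; rewrite {2}m30.
  by apply: leader_rows; rewrite ?Yn.
have {}H3 (i : 'I_m3) : [/\ n <= k + s3 * k.-1 + d3, d3 <= 2 & d3 * c <= n - 3 - s3 * k.-1].
  by case: H3 => //; apply: leq_ltn_trans (ltn_ord i).
have up (z : 'I_n) (C : {set 'I_n}) p : z \notin Y -> z \in C -> #|C| = p.+1 ->
    n - 3 - p <= #|Y :\: C|.
  move=> zY zC; rewrite (cardsD1 z C) zC => -[<-]; rewrite cardsD Yn leq_sub2l //.
  apply/subset_leq_card/subsetP=> x; rewrite in_setI in_setD1 => /andP[xY ->].
  by rewrite andbT; apply: contraNneq zY => <-.
have lo (Z C : {set 'I_n}) : C \subset Z :|: Y -> #|Y :\: C| + #|C| <= n - 3 + #|Z|.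
  move=> CZ; rewrite -Yn -(cardsID C Y) [leqRHS]addnAC [leqRHS]addnC leq_add2l.
  rewrite addnC; apply: leq_trans (leq_card_setU _ _).
  apply/subset_leq_card/subsetP=> x xC; have := subsetP CZ x xC.
  by rewrite !in_setU in_setI xC andbT.
have zcov m (F : 'I_m -> {set {set 'I_n}}) (z : 'I_n) i : F i != set0 ->
    (forall A, A \in F i -> z \in A) -> z \in cover (F i).
  by case/set0Pn=> A AF zA; apply/bigcupP; exists A; rewrite // zA.
have F2z i : o2 \in cover (F2 i) by apply: zcov => // A /F2k[].
have F3z i : o3 \in cover (F3 i) by apply: zcov => // A /F3k[].
have sk2 : 0 < s2 * k.-1 by rewrite muln_gt0 s20.
pose F (i : 'I_m2 + 'I_m3) := match i with inl i => F2 i | inr i => F3 i end.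
pose a (i : 'I_m2 + 'I_m3) := if i is inl _ then o2 else o3.
pose d (i : 'I_m2 + 'I_m3) := if i is inl _ then d2 else d3.
have -> : m2 + m3 = #|{: 'I_m2 + 'I_m3}| by rewrite card_sum !card_ord.
have kE : k.-1.+1 = k by lia.
have F23 i j : [disjoint F2 i & F3 j].
  rewrite -setI_eq0; apply/eqP/setP=> A; rewrite !inE; apply/negP=> /andP[].
  by move=> /F2k[_ _ o2A] /F3k[_ /subsetP/(_ _ o2A)]; rewrite !inE.
apply: (@hadwiger_star_extend n k o1 _ F a Y d c) => //.
- lia.
- lia.
- by rewrite !inE.
- by case=> i; rewrite !inE.
- case=> i A /=.
    case/F2k=> kA AG o2A; rewrite kA kE; split=> //.
    by apply/negP=> /(subsetP AG); rewrite !inE.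
  case/F3k=> kA AG o3A; rewrite kA kE; split=> //.
  by apply/negP=> /(subsetP AG); rewrite !inE.
- by case.
- case=> i [] j ij //=.
  + by apply: F2dis; apply: contra ij => /eqP->.
  + by rewrite disjoint_sym.
  + by apply: F3dis; apply: contra ij => /eqP->.
- case=> i /=.
    by apply: leq_trans d2c _; apply: (up o2); rewrite ?inE //; case: (F2cov i).
  by case: (H3 i) => _ _ d3c; apply: leq_trans d3c _; apply: (up o3) => //; case: (F3cov i).
(* A row through [o2] misses at most [k + d2 - 2] points of [Y], one through [o3] at most
   [k + d3 - 3]; the bounds on [d2] and [d3] keep both below [k]. *)
- case=> i /= d0.
    have [sC cC] := F2cov i; have := @lo [set o2; o3] (cover (F2 i)).
    rewrite cards2 cC -setUA => /(_ sC) /=; move: sk2 cov2.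
    by move: (s2 * _) #|_ :\: _| => p p'; lia.
  have [sC cC] := F3cov i; have := @lo [set o3] (cover (F3 i)).
  rewrite cards1 cC => /(_ sC) /=; case: (H3 i).
  by move: (s3 * _) #|_ :\: _| => p p'; lia.
- case=> i /=; first by have [_ ->] := F2cov i; lia.
  by have [_ ->] := F3cov i; case: (H3 i); lia.
by rewrite Yn big_sumType /= !sum_nat_const !card_ord mulnC [m3 * _]mulnC.
Qed.

(** * Counting rows *)

(* Proves an inequality of polynomials over [nat] whose difference has only
   nonnegative coefficients. The normal form [c] is read off a proof [pf] that is
   then discarded, since the kernel is slow to check [ring_simplify]. *)
Ltac poly_le :=
  zify; apply/Z.leb_le;
  match goal with |- (?a <= ?b)%Z =>
    let pf := constr:(ltac:(eexists; ring_simplify; reflexivity)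
                      : exists c, (b - a)%Z = c) in
    match pf with ex_intro _ ?c _ =>
      apply/Z.le_0_sub; replace (b - a)%Z with c by ring
    end
  end;
  repeat first [ apply: Z.add_nonneg_nonneg | apply: Z.mul_nonneg_nonneg
               | apply: Z.pow_nonneg ]; lia.

Lemma leq_bin1 m j : 0 < j < m -> m <= 'C(m, j).
Proof.
elim: m j => // m IHm [//|[|j]] /andP[_ ltj]; first by rewrite bin1.
rewrite binS; have [ltjm|] := ltnP j.+2 m.
  by have := IHm j.+2 ltjm; have := bin_gt0 m j.+1; lia.
move=> lem; have -> : m = j.+2 by lia.
by rewrite binn binSn add1n.
Qed.

Lemma leq_bin2 m j : 1 < j -> j.+2 <= m -> 'C(m, 2) <= 'C(m, j).
Proof.
elim: m j => // m IHm [//|[//|j]] _ ltj; rewrite binS [leqRHS]binS bin1.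
have [lejm|ltmj] := leqP j.+4 m.
  by rewrite leq_add ?IHm // leq_bin1 //; lia.
have -> : m = j.+3 by lia.
by rewrite binSn addnC leq_add2l -(@bin_sub j.+3 2) // subSS subSS subn0.
Qed.

(* The inequality is multiplied by [h * n2 * n3 * nk]; [e] bounds what is lost
   by rounding down in [m]. *)
Lemma star_count r q k m e h g X S A n1 n2 n3 nk :
  0 < h -> 0 < n2 -> 0 < n3 -> 0 < nk ->
  S * nk = n1 * A -> g * A <= h * n2 * X -> X <= q * m + e ->
  e * (n2 * n3) <= e * (2 * A) ->
  h * (r * n1 * n2 * n3 + 2 * e * k * nk) <= k * nk * g * n3 ->
  r * S <= q * k * m.
Proof.
move=> h0 n20 n30 nk0 eS gA Xm eA poly.
have P0 : 0 < h * n2 * n3 * nk by rewrite !muln_gt0 h0 n20 n30 nk0.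
rewrite -(leq_pmul2l P0).
have H1 := leq_mul poly (leqnn A).
have H2 := leq_mul (leqnn (k * nk * n3)) gA.
have H3 := leq_mul (leqnn (k * nk * n3 * h * n2)) Xm.
have H4 := leq_mul (leqnn (h * k * nk)) eA.
have H5 := congr1 (muln (h * n2 * n3 * r)) eS.
lia.
Qed.

(** In [k * 'C(n, k) = (q * k + r) * 'C(n.-1, k.-1)] the star pays for the summand [q * k] and the
    [m] rows for [r]. *)
Lemma bin_star_le n k q r m : 0 < k -> n = q * k + r ->
  r * 'C(n.-1, k.-1) <= q * k * m -> 'C(n, k) <= q * ('C(n.-1, k.-1) + m).
Proof.
case: k => // k _ nE le_r; rewrite -(leq_pmul2l (ltn0Sn k)) -mul_bin_diag /= {1}nE.
move: le_r => /=; lia.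
Qed.

(* For [n = q * k + r] the first inequality says that [q] times the number of
   branch sets is at least ['C(n, k)]; see [bin_star_le]. *)
Definition enough_rows n k q r := exists2 m,
  r * 'C(n.-1, k.-1) <= q * k * m &
  'C(n.-1, k.-1) + m <= hadwiger_number (compl_graph (kneser n k)).

(** * Enough rows, by cases on [q] and [r] *)

Lemma ge4_poly n k q r : 3 < q -> 0 < r < k.+2 -> n.+4 = q * k.+2 + r ->
  r * n.+3 * n.+2 * n.+1 <=
    k.+2 * (n.+3 - k.+1) * (q * k.+1 * (n.+1 + (n.+2 - k.+1))).
Proof.
move=> q3 /andP[r0 rk] nE.
(* The slack variables [p], [x], [t] absorb the hypotheses, so that [poly_le] applies. *)
have [p qE] : exists p, q = p + 4 by exists (q - 4); lia.
have [x rE] : exists x, r = x.+1 by exists r.-1; lia.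
have [t kE] : exists t, k = x + t by exists (k - x); lia.
have nE' : n = (p + 4) * (x + t) + 2 * p + 5 + x by move: nE; rewrite qE rE kE; lia.
have -> : n.+3 - k.+1 = (p + 3) * (x + t + 2) + x.+1 by rewrite nE' kE; lia.
have -> : n.+2 - k.+1 = (p + 3) * (x + t + 2) + x by rewrite nE' kE; lia.
rewrite nE' kE qE rE {nE nE' kE qE rE q3 r0 rk}.
by poly_le.
Qed.

(* One extra set per row through the third point is needed exactly when [k - 1]
   divides [n - 2], since such a row also misses the second point. *)
Lemma enough_rows_ge4 n k q r :
  2 < k -> 3 < q -> n = q * k + r -> 0 < r < k -> enough_rows n k q r.
Proof.
move=> k2 q3 nE /andP[r0 rk].
have [k' kE] : exists k', k = k'.+2 by exists k.-2; lia.
have [n' nE'] : exists n', n = n'.+4 by exists (n - 4); nia.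
have kn : 4 * k < n by nia.
have k'0 : 0 < k' by lia.
pose s2 := n'.+2 %/ k'.+1; pose s3 := n'.+1 %/ k'.+1.
pose d3 : nat := (n'.+1 %% k'.+1 == k').
have E2 : n'.+2 * 'C(n'.+1, k') = k'.+1 * 'C(n'.+2, k'.+1).
  exact: mul_bin_diag.
have E4 : n'.+1 * 'C(n', k') = k'.+1 * 'C(n'.+1, k'.+1) by exact: mul_bin_diag.
have E5 : k'.+1 * 'C(n', k'.+1) = (n' - k') * 'C(n', k') by exact: mul_bin_left.
have E3 : n'.+2 * 'C(n'.+1, k'.+1) = (n'.+2 - k'.+1) * 'C(n'.+2, k'.+1).
  exact: mul_bin_down.
have E1 : n'.+3 * 'C(n'.+2, k'.+1) = (n'.+3 - k'.+1) * 'C(n'.+3, k'.+1).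
  exact: mul_bin_down.
have D2 := divn_eq n'.+2 k'.+1; have M2 := ltn_pmod n'.+2 (ltn0Sn k').
have D3 := divn_eq n'.+1 k'.+1; have M3 := ltn_pmod n'.+1 (ltn0Sn k').
exists ('C(n'.+1, k') + 'C(n', k')); last first.
  (* Rows are as long as possible. Since [(k - 1) * 'C(n - 2, k - 1) = (n - 2) * 'C(n - 3, k - 2)],
     the blocks suffice for ['C(n - 3, k - 2)] rows through the second point, and likewise for
     ['C(n - 4, k - 2)] through the third. *)
  rewrite nE' kE; apply: (@hadwiger_leaders _ _ s2 _ 0 s3 _ d3 1) => //.
  - lia.
  - split; rewrite ?divn_gt0 //=; first lia.
      by rewrite /s2; lia.
    rewrite -(leq_pmul2l (ltn0Sn k')) -[leqRHS]E2 mulnA leq_mul2r.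
    by rewrite mulnC leq_divM orbT.
  - by split=> //=; rewrite -/s2 in D2; lia.
  - move=> _; split.
      split; rewrite ?divn_gt0 //=; first lia.
        by rewrite /s3; lia.
      rewrite -(leq_pmul2l (ltn0Sn k')) -[leqRHS]E4 mulnA leq_mul2r.
      by rewrite mulnC leq_divM orbT.
    rewrite /d3 /s3; split=> //=.
    + by move: D3 M3; set x := _ %/ _; case: eqP; lia.
    + by case: eqP.
    + by move: D3; set x := _ %/ _; case: eqP; lia.
  have -> : n'.+4 - 3 - 1 = n' by lia.
  have -> : n'.+4 - 3 = n'.+1 by lia.
  rewrite [X in X - _]binS addKn mul0n add0n.
  apply: (@leq_trans 'C(n', k')); first by rewrite /d3; case: eqP; lia.
  rewrite -(leq_pmul2l (ltn0Sn k')) E5 leq_mul2r; lia.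
apply: (@star_count r q k _ 0 n'.+1 (q * k'.+1 * (n'.+1 + (n'.+2 - k'.+1)))
  (q * ('C(n'.+1, k') + 'C(n', k'))) _ 'C(n'.+2, k'.+1) n'.+3 n'.+2 n'.+1
  (n'.+3 - k'.+1)) => //; rewrite ?addn0 //.
- lia.
- by rewrite E1 nE' kE mulnC.
- have H2 := congr1 (muln (q * n'.+1)) E2.
  have H3 := congr1 (muln (q * k'.+1)) E3.
  have H4 := congr1 (muln (q * n'.+2)) E4.
  lia.
- rewrite [leqRHS]mulnC leq_mul2l; apply/orP; right.
  by rewrite kE; apply: ge4_poly; lia.
Qed.

Lemma bin_binn2 n j : 1 < j -> j <= n -> n.+2 * n.+1 <= 2 * 'C(n.+2, j).
Proof.
move=> j1 jn; apply: leq_trans (_ : 2 * 'C(n.+2, 2) <= _).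
  by rewrite -mul_bin_diag bin1.
by rewrite leq_mul2l leq_bin2.
Qed.

(** Counts rows of length [q] through both points. Each rounding loses at most [q - 1], hence
    [e = 2 * q.-1] in [star_count]. *)
Lemma floor_count n k q r :
  2 < k -> (q == 2) && (r < k) || (q == 3) && (r + 3 <= k) -> 0 < r ->
  n.+4 = q * k + r ->
  r * 'C(n.+3, k.-1) <= q * k * ('C(n.+2, k.-1) %/ q + 'C(n.+1, k.-1) %/ q).
Proof.
move=> k2 qr r0 nE; have [k' kE] : exists k', k = k'.+2 by exists k.-2; lia.
rewrite kE /= in nE qr k2 *.
have E3 : n.+2 * 'C(n.+1, k'.+1) = (n.+2 - k'.+1) * 'C(n.+2, k'.+1).
  exact: mul_bin_down.
have E1 : n.+3 * 'C(n.+2, k'.+1) = (n.+3 - k'.+1) * 'C(n.+3, k'.+1).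
  exact: mul_bin_down.
have q0 : 0 < q by lia.
have kn : k' + 2 <= n by case/orP: qr nE => /andP[/eqP-> _]; lia.
have A2 : n.+2 * n.+1 <= 2 * 'C(n.+2, k'.+1) by apply: bin_binn2; lia.
have [D2 D3] := (divn_eq 'C(n.+2, k'.+1) q, divn_eq 'C(n.+1, k'.+1) q).
have [M2 M3] := (ltn_pmod 'C(n.+2, k'.+1) q0, ltn_pmod 'C(n.+1, k'.+1) q0).
apply: (@star_count r q k'.+2 _ (2 * q.-1) 1 (n.+2 + (n.+2 - k'.+1))
  ('C(n.+2, k'.+1) + 'C(n.+1, k'.+1)) _ 'C(n.+2, k'.+1) n.+3 n.+2 n.+1
  (n.+3 - k'.+1)) => //.
- by lia.
- by rewrite E1 mulnC.
- by rewrite mul1n mulnDr E3 mulnDl leqnn.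
- rewrite mulnDr ![q * (_ %/ _)]mulnC.
  by move: D2 D3 M2 M3; set x := _ %/ q; set y := _ %/ q; lia.
- by rewrite leq_mul2l A2 orbT.
have [x rE] : exists x, r = x.+1 by exists r.-1; lia.
case/orP: qr nE => /andP[/eqP-> rk] nE; rewrite mul1n.
  have [t kE'] : exists t, k' = x + t by exists (k' - x); lia.
  have [nE3 -> ->] : [/\ n = 2 * (x + t) + x + 1,
      n.+3 - k'.+1 = (x + t + 2) + x.+1 & n.+2 - k'.+1 = (x + t + 2) + x].
    by split; lia.
  by rewrite nE3 kE' rE /=; poly_le.
have [t kE'] : exists t, k' = x + t + 2 by exists (k' - x - 2); lia.
have [nE3 -> ->] : [/\ n = 3 * (x + t) + x + 9,
    n.+3 - k'.+1 = 2 * (x + t + 4) + x.+1 & n.+2 - k'.+1 = 2 * (x + t + 4) + x].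
  by split; lia.
by rewrite nE3 kE' rE /=; poly_le.
Qed.

(** The condition [r + q <= k] says exactly that rows of length [q] cover enough points without
    extra sets. *)
Lemma enough_rows_low n k q r :
  2 < k -> (q == 2) || (q == 3) -> n = q * k + r -> 0 < r -> r + q <= k ->
  enough_rows n k q r.
Proof.
move=> k2 q23 nE r0 rqk.
have q01 : 1 < q by lia.
have [n' nE'] : exists n', n = n'.+4.
  by exists (n - 4); case/orP: q23 nE => /eqP->; lia.
have qk : q * k.-1 = q * k - q by rewrite -subn1 mulnBr muln1.
have qk2 : 2 * k <= q * k by rewrite leq_mul2r q01 orbT.
exists ('C(n'.+2, k.-1) %/ q + 'C(n'.+1, k.-1) %/ q); rewrite nE'.
  apply: floor_count => //; last by rewrite -nE'.
  by case/orP: q23 => /eqP q_eq; rewrite q_eq in rqk *; lia.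
have rows N : q * ('C(N, k.-1) %/ q) <= 'C(N, k.-1) by rewrite mulnC leq_divM.
apply: (@hadwiger_leaders _ _ q _ 0 q _ 0 1) => //.
- by lia.
- by rewrite -nE' nE; lia.
- by split; [lia|rewrite qk; lia|apply: rows].
- by split=> //; rewrite qk; lia.
- move=> _; split; first by split; [lia|rewrite qk; lia|apply: rows].
  by split=> //; rewrite qk; lia.
Qed.

Lemma enough_rows_3 n k r :
  2 < k -> n = 3 * k + r -> 0 < r -> k <= r + 2 -> r < k -> enough_rows n k 3 r.
Proof.
move=> k2 nE r0 kr rk.
have [k' kE] : exists k', k = k'.+2 by exists k.-2; lia.
have [n' nE'] : exists n', n = n'.+4 by exists (n - 4); lia.
have E2 : n'.+2 * 'C(n'.+1, k') = k'.+1 * 'C(n'.+2, k'.+1).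
  exact: mul_bin_diag.
have E3 : n'.+2 * 'C(n'.+1, k'.+1) = (n'.+2 - k'.+1) * 'C(n'.+2, k'.+1).
  exact: mul_bin_down.
have E1 : n'.+3 * 'C(n'.+2, k'.+1) = (n'.+3 - k'.+1) * 'C(n'.+3, k'.+1).
  exact: mul_bin_down.
have E6 : n'.+1 * 'C(n', k'.+1) = (n'.+1 - k'.+1) * 'C(n'.+1, k'.+1).
  exact: mul_bin_down.
have A2 : n'.+2 * n'.+1 <= 2 * 'C(n'.+2, k'.+1) by apply: bin_binn2; lia.
have D3 := divn_eq 'C(n'.+1, k'.+1) 3.
have M3 := @ltn_pmod 'C(n'.+1, k'.+1) 3 isT.
exists ('C(n'.+1, k') + 'C(n'.+1, k'.+1) %/ 3).
  rewrite nE' kE.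
  apply: (@star_count r 3 k'.+2 _ 2 1 (3 * k'.+1 + (n'.+2 - k'.+1))
    (3 * 'C(n'.+1, k') + 'C(n'.+1, k'.+1)) _ 'C(n'.+2, k'.+1) n'.+3 n'.+2 n'.+1
    (n'.+3 - k'.+1)) => //.
  - by lia.
  - by rewrite E1 mulnC.
  - by rewrite mul1n mulnDr E3 mulnDl mulnCA E2 mulnA leqnn.
  - by move: D3 M3; set x := _ %/ 3; lia.
  - by rewrite leq_mul2l A2 orbT.
  have [x kE'] : exists x, k' = x + 1 by exists k'.-1; lia.
  have [rE|rE] : r = k' \/ r = k'.+1 by lia.
    have [nE3 -> ->] : [/\ n' = 4 * x + 6, n'.+3 - k'.+1 = 3 * x + 7
        & n'.+2 - k'.+1 = 3 * x + 6] by split; lia.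
    by rewrite nE3 rE kE' mul1n; poly_le.
  have [nE3 -> ->] : [/\ n' = 4 * x + 7, n'.+3 - k'.+1 = 3 * x + 8
      & n'.+2 - k'.+1 = 3 * x + 7] by split; lia.
  by rewrite nE3 rE kE' mul1n; poly_le.
(* As [k <= r + 2], rows of length 4 fit through the second point. Rows of length 3 through the
   third fall short by [r + 3 - k] points, that is, by one or two. *)
rewrite nE' kE; apply: (@hadwiger_leaders _ _ 4 _ 0 3 _ (r - k' + 1) 1) => //.
- by lia.
- split=> //=; first by lia.
  rewrite -(leq_pmul2l (ltn0Sn k')) -[leqRHS]E2 mulnA leq_mul2r; lia.
- by split=> //=; lia.
- move=> _; split; first by split=> //=; [lia|rewrite mulnC leq_divM].
  by split=> //=; lia.
have -> : n'.+4 - 3 - 1 = n' by lia.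
have -> : n'.+4 - 3 = n'.+1 by lia.
rewrite [X in _ <= X - _]binS addKn mul0n add0n.
apply: (@leq_trans (2 * ('C(n'.+1, k'.+1) %/ 3))); first by rewrite leq_mul2r; lia.
rewrite -(leq_pmul2l (ltn0Sn n')) E6.
(* At least two thirds of the [(k - 1)]-subsets counted by ['C(n'.+1, k'.+1)] avoid a given point,
   which leaves two extra sets per row. *)
have H : 2 * n'.+1 <= 3 * (n'.+1 - k'.+1) by lia.
have H1 := leq_mul H (leqnn ('C(n'.+1, k'.+1) %/ 3)).
have H2 : 3 * ('C(n'.+1, k'.+1) %/ 3) <= 'C(n'.+1, k'.+1).
  by rewrite mulnC leq_divM.
have {H2} := leq_mul (leqnn (n'.+1 - k'.+1)) H2.
move: H1; set x := _ %/ 3; lia.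
Qed.

(** The first two terms of Vandermonde's sum for [3 * k - 1 = (k - 1) + 2 * k] suffice, since
    ['C(2 * k, k) >= 'C(2 * k, k.+1)]. *)
Lemma central_bin_le k : k * 'C(2 * k, k.+1) <= 'C(3 * k - 1, k.+1).
Proof.
case: k => // k.
have -> : 3 * k.+1 - 1 = k + 2 * k.+1 by lia.
rewrite -Vandermonde big_ord_recl big_ord_recl /= bin0 mul1n bin1 /bump /= subn0.
rewrite addnA; apply: leq_trans (leq_addr _ _).
rewrite mulSn leq_add2l leq_mul2l; apply/orP; right.
have -> : k.+2 - 1 = k.+1 by lia.
rewrite -(leq_pmul2l (ltn0Sn k.+1)) mul_bin_left leq_mul2r; lia.
Qed.

(** Here [n = 3 * k - 1], and rows of length 2 fall one point short, so each needs an extra set. Its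
    piece is the whole missed part of size [k - 2], and [P] is the resulting number of
    candidates. *)
Lemma enough_rows_2 n k :
  3 < k -> n = 2 * k + k.-1 -> enough_rows n k 2 k.-1.
Proof.
move=> k3 nE.
have [k' kE] : exists k', k = k'.+2 by exists k.-2; lia.
have [n' nE'] : exists n', n = n'.+4 by exists (n - 4); lia.
rewrite nE' kE /= in nE k3 *.
have E3 : n'.+2 * 'C(n'.+1, k'.+1) = (n'.+2 - k'.+1) * 'C(n'.+2, k'.+1).
  exact: mul_bin_down.
have E1 : n'.+3 * 'C(n'.+2, k'.+1) = (n'.+3 - k'.+1) * 'C(n'.+3, k'.+1).
  exact: mul_bin_down.
have E7 : k'.+2 * 'C(n'.+1, k'.+2) = (n'.+1 - k'.+1) * 'C(n'.+1, k'.+1).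
  exact: mul_bin_left.
pose P := 'C(n'.+1, k'.+2) - 'C(2 * k'.+1, k'.+2).
have leP : k' * 'C(n'.+1, k'.+2) <= k'.+1 * P.
  have := central_bin_le k'.+1; rewrite (_ : 3 * k'.+1 - 1 = n'.+1); last by lia.
  by rewrite /P mulnBr mulSn; set a := k'.+1 * _; set b := k' * 'C(2 * _, _); lia.
have count_P : k'.+1 * 'C(n'.+3, k'.+1) <= 2 * k'.+2 * P.
  apply: (@star_count k'.+1 2 k'.+2 P 0 (k'.+1 * k'.+2)
    (2 * k' * (n'.+1 - k'.+1) * (n'.+2 - k'.+1)) (2 * P) _ 'C(n'.+2, k'.+1)
    n'.+3 n'.+2 n'.+1 (n'.+3 - k'.+1)) => //.
  - by lia.
  - by rewrite E1 mulnC.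
  - have H1 := leq_mul (leqnn (2 * k'.+2 * n'.+2)) leP.
    have H2 := congr1 (muln (2 * k' * n'.+2)) E7.
    have H3 := congr1 (muln (2 * k' * (n'.+1 - k'.+1))) E3.
    by lia.
  - by rewrite addn0.
  have [x kE'] : exists x, k' = x + 2 by exists (k' - 2); lia.
  have [nE3 -> -> ->] : [/\ n' = 3 * x + 7, n'.+3 - k'.+1 = 2 * x + 7,
      n'.+2 - k'.+1 = 2 * x + 6 & n'.+1 - k'.+1 = 2 * x + 5] by split; lia.
  by rewrite nE3 kE'; poly_le.
have count_floor : k'.+1 * 'C(n'.+3, k'.+1) <=
    2 * k'.+2 * ('C(n'.+2, k'.+1) %/ 2 + 'C(n'.+1, k'.+1) %/ 2).
  by apply: (@floor_count n' k'.+2 2 k'.+1); lia.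
(* The number of rows may exceed neither [P] nor the number of rows available; the least [m] that
   suffices respects both bounds. *)
have exE : exists m, k'.+1 * 'C(n'.+3, k'.+1) <= 2 * k'.+2 * m by exists P.
have [m count_m min_m] := ex_minnP exE.
exists m => //.
have leA := min_m _ count_floor; have {}leP := min_m _ count_P.
pose m2 := minn m ('C(n'.+2, k'.+1) %/ 2).
have mE : m = m2 + (m - m2) by rewrite subnKC // geq_minl.
rewrite {1}mE.
apply: (@hadwiger_leaders _ _ 2 m2 1 2 (m - m2) 1 k') => //=.
- by lia.
- by lia.
- split=> //; first by lia.
  by apply: leq_trans (leq_divM _ 2); rewrite mulnC leq_mul2r geq_minr orbT.
- by split=> //; lia.
- move=> _; split; [split=> //; first by lia|by split=> //; lia].
  apply: leq_trans (leq_divM _ 2); rewrite mulnC leq_mul2r /=.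
  by move: leA; rewrite /m2; set x := _ %/ 2; set y := _ %/ 2; lia.
rewrite !mul1n -mE; apply: leq_trans leP _; rewrite /P.
have -> : n'.+4 - 3 = n'.+1 by lia.
by rewrite (_ : n'.+1 - k' = 2 * k'.+1); last by lia.
Qed.

(** Seven rows are needed, but rows of length 2 alone would have only ['C(5, 3) - 'C(4, 3) = 6]
    candidates for extra sets. Five rows of length 3 through the second point use up all
    ['C(6, 2) = 15] pairs and need no extra set. *)
Lemma enough_rows_8_3 : enough_rows 8 3 2 2.
Proof.
exists (5 + 2) => //.
by apply: (@hadwiger_leaders _ _ 3 5 0 2 2 1 1).
Qed.

Theorem theorem1 (n k : nat) (hk : 5 <= 2 * k + 1) (hn : 2 * k + 1 <= n) :
  chromatic_number (compl_graph (kneser n k)) <=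
    hadwiger_number (compl_graph (kneser n k)).
Proof.
have k0 : 0 < k by lia.
have nE := divn_eq n k; have rk := ltn_pmod n k0.
have q2 : 1 < n %/ k by rewrite leq_divRL; lia.
move: (n %/ k) (n %% k) nE rk q2 => q r nE rk q2.
suff [m le_r le_h] : enough_rows n k q r.
  apply: leq_trans le_h; apply: (@chromatic_number_le n k q) => //; first by lia.
    by rewrite nE leq_addr.
  exact: bin_star_le le_r.
have [r0|r0] := posnP r.
  (* When [k] divides [n], the star alone is large enough. *)
  exists (0 + 0); first by rewrite r0 mul0n.
  have D := divn_eq (n - 2) k.-1; have M := @ltn_pmod (n - 2) k.-1.
  apply: (@hadwiger_leaders _ _ ((n - 2) %/ k.-1) 0 0 0 0 0 1) => //.
  - by lia.
  - by lia.
  - by rewrite divn_gt0 ?muln0; [split=> //; lia|lia].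
  - by split=> //; move: D M; set x := _ %/ _; lia.
have [k2|k2] := leqP k 2.
  have [kE rE] : k = 2 /\ r = 1 by lia.
  (* One row suffices: all pairs joining the second point to the [n - 2] points other than it and
     the first. *)
  exists (1 + 0); first by rewrite rE kE bin1; lia.
  apply: (@hadwiger_leaders _ _ (n - 2) 1 0 0 0 0 1) => //; rewrite ?kE //= ?bin1.
  - by lia.
  - by split; lia.
  - by split=> //; lia.
have [q4|q4] := leqP 4 q; first by apply: enough_rows_ge4 => //; rewrite r0.
have [rqk|kqr] := leqP (r + q) k; first by apply: enough_rows_low => //; lia.
(* Now [k < r + q]: for [q = 3] this leaves [r] equal to [k - 2] or [k - 1], for [q = 2] only
   [k - 1]. *)
have [qE|qE] : q = 3 \/ q = 2 by lia.
  by rewrite qE; apply: enough_rows_3; lia.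
have rE : r = k.-1 by lia.
have [k4|k3] := leqP 4 k; first by rewrite qE rE; apply: enough_rows_2; lia.
have kE : k = 3 by lia.
have -> : n = 8 by lia.
by rewrite qE rE kE; apply: enough_rows_8_3.
Qed.
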